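(* Let $k \ge 3$ be an even integer and let $m \ge 1$. Let $H$ be an induced subgraph of the torus $C_k^m$ such that $|V(H)|$ divides $k^m$. Then there exists $n_0$ such that, for all $n \ge n_0$, the torus $C_k^n$ admits a perfect induced $H$-packing.
   Context: For integers $k \ge 3$ and $n \ge 1$, the torus $C_k^n$ (the $n$-th Cartesian power of the cycle $C_k$) is the graph with vertex set $\{0,\ldots,k-1\}^n$ in which two vertices $u=(u_1,\ldots,u_n)$ and $v=(v_1,\ldots,v_n)$ are adjacent if and only if they differ in exactly one coordinate $i$, and there $u_i - v_i \equiv \pm 1 \pmod k$. For graphs $G$ and $H$, an $H$-packing of $G$ is a collection of vertex-disjoint subgraphs of $G$ each isomorphic to $H$; it is perfect if every vertex of $G$ lies in one of its members, and induced if each member is an induced subgraph of $G$. *)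

(* Defs.v *)
From mathcomp Require Import all_boot.

Set Implicit Arguments.
Unset Strict Implicit.
Unset Printing Implicit Defensive.

Record sgraph := SGraph {
  vertex :> finType;
  adj : rel vertex;
  adj_sym : symmetric adj;
  adj_irrefl : irreflexive adj }.

Definition graph_iso (G H : sgraph) : Prop :=
  exists2 f : G -> H, bijective f & forall x y : G, adj (f x) (f y) = adj x y.

(* Edges are the unordered pairs {x, y} with x adjacent to y. *)
Definition edges (G : sgraph) : {set {set G}} :=
  [set e | [exists x : G, [exists y : G, adj x y && (e == [set x; y])]]].

Definition is_subgraph (G : sgraph) (K : {set G} * {set {set G}}) : bool :=
  (K.2 \subset edges G) && [forall e in K.2, e \subset K.1].

Definition subgraph (G : sgraph) : finType :=
  {K : {set G} * {set {set G}} | is_subgraph K}.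

Definition sub_vertices (G : sgraph) (K : subgraph G) : {set G} := (val K).1.
Definition sub_edges (G : sgraph) (K : subgraph G) : {set {set G}} := (val K).2.

Definition induced (G : sgraph) (K : subgraph G) : bool :=
  sub_edges K == [set e in edges G | e \subset sub_vertices K].

Section SubgraphAsGraph.
Variables (G : sgraph) (K : subgraph G).

Definition sub_vertex : finType := {x : G | x \in sub_vertices K}.

Definition sub_adj : rel sub_vertex :=
  fun u v => [set val u; val v] \in sub_edges K.

Lemma sub_adj_sym : symmetric sub_adj.
Proof. by move=> u v; rewrite /sub_adj setUC. Qed.

Lemma sub_adj_irrefl : irreflexive sub_adj.
Proof.
move=> u; apply/negP => uK.
have /andP[/subsetP sKE _] := valP K.
have := sKE _ uK; rewrite inE => /existsP[x /existsP[y /andP[xy /eqP exy]]].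
have: x \in [set val u; val u] by rewrite exy set21.
have: y \in [set val u; val u] by rewrite exy set22.
rewrite !inE !orbb => /eqP yu /eqP xu.
by rewrite xu yu adj_irrefl in xy.
Qed.

Definition graph_of_subgraph : sgraph := SGraph sub_adj_sym sub_adj_irrefl.

End SubgraphAsGraph.

Definition packing (H G : sgraph) (P : {set subgraph G}) : Prop :=
  (forall K : subgraph G, K \in P -> graph_iso (graph_of_subgraph K) H) /\
  (forall K L : subgraph G, K \in P -> L \in P -> K != L ->
     [disjoint sub_vertices K & sub_vertices L]).

Definition perfect_packing (G : sgraph) (P : {set subgraph G}) : Prop :=
  forall x : G, exists2 K : subgraph G, K \in P & x \in sub_vertices K.

Definition induced_packing (G : sgraph) (P : {set subgraph G}) : Prop :=
  forall K : subgraph G, K \in P -> induced K.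

Section Torus.
Variables k n : nat.

(* The first conjunct says that i is the only coordinate where u and v
   differ; it makes the relation irreflexive even when k = 1, where every
   residue satisfies a = a + 1 mod k. *)
Definition torus_adj (u v : {ffun 'I_n -> 'I_k}) : bool :=
  [exists i : 'I_n,
     [forall j : 'I_n, (u j != v j) == (j == i)] &&
     ((u i == v i + 1 %[mod k]) || (v i == u i + 1 %[mod k]))].

Lemma torus_adj_sym : symmetric torus_adj.
Proof.
move=> u v; apply: eq_existsb => i; rewrite orbC; congr (_ && _).
by apply: eq_forallb => j; rewrite (eq_sym (u j)).
Qed.

Lemma torus_adj_irrefl : irreflexive torus_adj.
Proof.
move=> u; rewrite /torus_adj; apply/existsP => -[i /andP[/forallP h _]].
by have := h i; rewrite !eqxx.
Qed.

Definition torus : sgraph := SGraph torus_adj_sym torus_adj_irrefl.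

End Torus.

(* Main.v *)
Require Import Defs.
From mathcomp Require Import all_boot all_algebra.
From mathcomp Require Import zify ring.

(* The cycle [C_k], [k] even, is an induced subgraph of a cube, so a copy [T] of
   [H] can be placed inside [{0,1}^d], a subset of the torus [Z_k^d]. Only
   translates of [T], and products of such configurations, are used as tiles.

   Algebra: modulo a prime [p] dividing [k], the constant function 1 is a
   combination of translates of the indicator of [T]; this is where
   [T] being in [{0,1}^d] matters. Multiplying such congruences over the prime
   factors of [|T|], and using that all the translates of [T] cover each point
   [|T|] times, the constant 1 on some power of [Z_k^d] is an integral
   combination of tiles.

   Combinatorics: if the constant 1 on [X] is such a combination and [A], [B]
   are tileable, then [(A u B)^q x X] is tileable for large [q]. Indeed
   [B \ A], [A & B], [A \ B] are three cells such that consecutive ones can be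
   tiled together, so a boustrophedon makes [(A u B)^q] into a long path of
   cells, and [(A u B)^2q] into a large grid of cells, coloured like a
   chessboard. Over [x] in [X], remove from the grid a white cell for each
   positive tile containing [x], and a black one for each negative tile: the
   remaining cells are balanced, and can be matched if the removed cells are
   well placed; the removed cells are tiled in the direction of [X]. Merging in
   this way the tiles of a cover of the space one after the other, at the cost
   of raising the dimension, leads to a tiling of a whole torus. *)

Set Implicit Arguments.
Unset Strict Implicit.
Unset Printing Implicit Defensive.

Import GRing.Theory.

(** * Abstract tilings and their products *)

Record tspace := TSpace { points :> finType; tile : {set points} -> Prop }.

Inductive tileable (V : tspace) : {set V} -> Prop :=
| tileable0 : tileable set0
| tileable_add A X :
    tile A -> tileable X -> [disjoint A & X] -> tileable (A :|: X).

(** As in a Cartesian product of graphs: a tile extends along one factor, and the other coordinate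
    is frozen. *)
Definition tprod (V W : tspace) : tspace :=
  @TSpace (V * W)%type (fun X =>
    (exists A w, tile A /\ X = setX A [set w])
    \/ (exists v B, tile B /\ X = setX [set v] B)).

Section Tileable.
Variable V : tspace.
Implicit Types X Y Z : {set V}.

Lemma tileable_tile A : @tile V A -> tileable A.
Proof.
by move=> tA; rewrite -[A]setU0; apply: tileable_add => //;
  [apply: tileable0 | rewrite disjoint_sym disjoints_subset sub0set].
Qed.

Lemma tileableU X Y :
  tileable X -> tileable Y -> [disjoint X & Y] -> tileable (X :|: Y).
Proof.
move=> tX tY; elim: tX => [|A Z tA _ IH dAZ]; first by rewrite set0U.
rewrite -setUA -setI_eq0 setIUl setU_eq0 !setI_eq0 => /andP[dAY dZY].
apply: tileable_add => //; first exact: IH.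
by rewrite -setI_eq0 setIUr setU_eq0 !setI_eq0 dAZ.
Qed.

(** The main device for building tilings: label the points and tile each label class separately. *)
Lemma tileable_fibers (I : eqType) (f : V -> I) Z :
  (forall i, tileable [set z in Z | f z == i]) -> tileable Z.
Proof.
move=> tf; pose s := undup [seq f z | z <- enum Z].
have -> : Z = [set z in Z | f z \in s].
  apply/setP=> z; rewrite inE; case zZ: (z \in Z) => //=.
  by rewrite mem_undup map_f ?mem_enum.
have: uniq s by apply: undup_uniq.
elim: s => [|i s IH] /= => [_|/andP[iNs us]].
  rewrite (_ : [set _ in _ | _] = set0); first exact: tileable0.
  by apply/setP=> z; rewrite !inE in_nil andbF.
rewrite (_ : [set _ in _ | _] =
  [set z in Z | f z == i] :|: [set z in Z | f z \in s]); last first.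
  by apply/setP=> z; rewrite !inE -andb_orr.
apply: tileableU => //; first exact: IH.
rewrite -setI_eq0; apply/eqP/setP=> z; rewrite !inE.
by case: eqP => [->|]; rewrite ?(negbTE iNs) !(andbF, andFb).
Qed.

Lemma tileable_empty Z : Z =i set0 -> tileable Z.
Proof. by move/setP->; apply: tileable0. Qed.

End Tileable.

Section TileableProd.
Variables V W : tspace.

Lemma tileable_setXl (A : {set V}) (B : {set W}) :
  tileable A -> @tileable (tprod V W) (setX A B).
Proof.
move=> tA; apply: (@tileable_fibers (tprod V W) _ snd) => w.
case wB: (w \in B); last first.
  apply: tileable_empty => -[v u]; rewrite !inE /=.
  by case: eqP => [->|]; rewrite ?wB !(andbF, andFb).
rewrite (_ : [set _ in _ | _] = setX A [set w]); last first.
  apply/setP=> -[v u]; rewrite !inE /=.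
  by case: eqP => [->|]; rewrite ?wB !(andbT, andbF).
elim: tA => [|C X tC _ IH dCX].
  by apply: tileable_empty => -[v u]; rewrite !inE.
rewrite (_ : setX _ _ = setX C [set w] :|: setX X [set w]); last first.
  by apply/setP=> -[v u]; rewrite !inE /= andb_orl.
apply: (@tileable_add (tprod V W)) => //; first by left; exists C, w.
rewrite -setI_eq0; apply/eqP/setP=> -[v u]; rewrite !inE /=.
have /setP/(_ v) := disjoint_setI0 dCX.
by rewrite !inE -andbA (andbCA (_ == _)) andbA => ->.
Qed.

Lemma tileable_setXr (A : {set V}) (B : {set W}) :
  tileable B -> @tileable (tprod V W) (setX A B).
Proof.
move=> tB; apply: (@tileable_fibers (tprod V W) _ fst) => w.
case wA: (w \in A); last first.
  apply: tileable_empty => -[v u]; rewrite !inE /=.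
  by case: eqP => [->|]; rewrite ?wA !(andbF, andFb).
rewrite (_ : [set _ in _ | _] = setX [set w] B); last first.
  apply/setP=> -[v u]; rewrite !inE /=.
  by case: eqP => [->|]; rewrite ?wA !(andbT, andbF).
elim: tB => [|C X tC _ IH dCX].
  by apply: tileable_empty => -[v u]; rewrite !inE andbF.
rewrite (_ : setX _ _ = setX [set w] C :|: setX [set w] X); last first.
  by apply/setP=> -[v u]; rewrite !inE /= andb_orr.
apply: (@tileable_add (tprod V W)) => //; first by right; exists w, C.
rewrite -setI_eq0; apply/eqP/setP=> -[v u]; rewrite !inE /=.
have /setP/(_ u) := disjoint_setI0 dCX.
by rewrite !inE -andbA (andbCA (u \in C)) => ->; rewrite !andbF.
Qed.

(** [A x W] is tiled along [V]; the rest, [~: A x B], is tiled along [W]. *)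
Lemma tileable_or (A : {set V}) (B : {set W}) : tileable A -> tileable B ->
  @tileable (tprod V W) [set z | (z.1 \in A) || (z.2 \in B)].
Proof.
move=> tA tB.
rewrite (_ : [set _ | _] = setX A [set: W] :|: setX (~: A) B); last first.
  by apply/setP=> z; rewrite !inE andbT; case: (z.1 \in A).
apply: tileableU; [exact: tileable_setXl | exact: tileable_setXr |].
rewrite -setI_eq0; apply/eqP/setP=> -[v u]; rewrite !inE /=.
by case: (v \in A).
Qed.

End TileableProd.

(** * Matchings of a punctured grid of cells *)

(* The points [v] with [L <= k v] belong to no cell. *)
Definition cell_path (V : tspace) (k : V -> nat) (L : nat) :=
  forall j, j.+1 < L -> tileable [set v | (k v == j) || (k v == j.+1)].

(* The matching of the grid is described column by column: if the state is [e],
   the columns matched between slices [2 t] and [2 t + 1] are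
   [0, 2, ..., 2 (e - 1)]. *)
Definition low_even e j := ~~ odd j && (j < e.*2).

Section Grid.
Variables (V W : tspace) (k : V -> nat) (l : W -> nat) (T : nat).
Hypothesis k_path : cell_path k T.*2.+1.
Hypothesis l_path : cell_path l T.*2.+1.

(** Slice [i] and column [j] meet in one cell of a square grid of side [2 T + 1]. Two neighbouring
    cells form a tileable set, so a region is tileable as soon as its cells are perfectly
    matched. *)
Definition region (P : nat -> nat -> bool) : {set tprod V W} :=
  [set z | [&& k z.1 < T.*2.+1, l z.2 < T.*2.+1 & P (k z.1) (l z.2)]].

Lemma eq_region P Q :
  (forall i j, i < T.*2.+1 -> j < T.*2.+1 -> P i j = Q i j) ->
  region P = region Q.
Proof.
move=> PQ; apply/setP=> z; rewrite !inE.
by apply/andP/andP=> -[iL /andP[jL]]; [rewrite PQ | rewrite -PQ] => // pq;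
  rewrite iL jL.
Qed.

Lemma region_fibers (I : eqType) (f : nat -> nat -> I) P :
  (forall x, tileable (region (fun i j => P i j && (f i j == x)))) ->
  tileable (region P).
Proof.
move=> tP; apply: (@tileable_fibers (tprod V W) _ (fun z => f (k z.1) (l z.2))) => x.
rewrite (_ : [set _ in _ | _] = region (fun i j => P i j && (f i j == x))) //.
by apply/setP=> z; rewrite !inE -!andbA.
Qed.

Lemma region0 P : (forall i j, i < T.*2.+1 -> j < T.*2.+1 -> P i j = false) ->
  tileable (region P).
Proof.
move=> P0; rewrite (eq_region P0).
by apply: tileable_empty => z; rewrite !inE !andbF.
Qed.

Lemma vertical_region r (Q : pred nat) : r < T.*2 ->
  tileable (region (fun i j => ((i == r) || (i == r.+1)) && Q j)).
Proof.
move=> rT.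
rewrite (_ : region _ = setX [set v | (k v == r) || (k v == r.+1)]
                             [set w | (l w < T.*2.+1) && Q (l w)]).
  exact/tileable_setXl/k_path.
apply/setP=> -[v w]; rewrite !inE /=.
by case: (l w < _) (Q _) => -[]; rewrite ?andbF // !andbT; lia.
Qed.

Lemma horizontal_region r a n : a + n.*2 <= T.*2.+1 ->
  tileable (region (fun i j => (i == r) && (a <= j < a + n.*2))).
Proof.
move=> anT; apply: (@region_fibers _ (fun _ j => (j - a)./2)) => x.
case: (ltnP x n) => xn; last by apply: region0 => i j iL jL; lia.
rewrite (_ : region _ = setX [set v | (k v < T.*2.+1) && (k v == r)]
   [set w | (l w == a + x.*2) || (l w == (a + x.*2).+1)]).
  by apply/tileable_setXr/l_path; lia.
apply/setP=> -[v w]; rewrite !inE /=.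
by case: (k v < _) (k v == r) => -[]; rewrite ?andbF //=; lia.
Qed.

(* Removing one cell in slice [a] changes the state by one: below [2 e] the odd
   columns are matched vertically, and the rest of each slice horizontally. *)
Lemma swap_region r a b e : r < T.*2 -> e <= T ->
  (a == r) && (b == r.+1) || (a == r.+1) && (b == r) ->
  tileable (region (fun i j => (i == a) && ~~ low_even e j && (j != T.*2)
                            || (i == b) && ~~ low_even e.+1 j)).
Proof.
rewrite /low_even => rT eT ab.
(* Label 0: vertical pairs in the odd columns below [2 e]. Label 1: columns [2 e] to [2 T - 1] of
   slice [a]. Label 2: columns [2 e + 1] to [2 T] of slice [b]. Both intervals have even length
   [2 (T - e)]. *)
apply: (@region_fibers _ (fun i j =>
  if odd j && (j < e.*2) then 0 else if i == a then 1 else 2)) => -[|[|[|x]]].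
- rewrite (@eq_region _ (fun i j =>
    ((i == r) || (i == r.+1)) && (odd j && (j < e.*2)))).
    exact: vertical_region.
  by move=> i j iL jL; case: ifP; [lia | case: ifP; lia].
- rewrite (@eq_region _ (fun i j =>
    (i == a) && (e.*2 <= j < e.*2 + (T - e).*2))).
    by apply: horizontal_region; lia.
  by move=> i j iL jL; case: ifP; [lia | case: ifP; lia].
- rewrite (@eq_region _ (fun i j =>
    (i == b) && (e.*2.+1 <= j < e.*2.+1 + (T - e).*2))).
    by apply: horizontal_region; lia.
  by move=> i j iL jL; case: ifP; [lia | case: ifP; lia].
- by apply: region0 => i j iL jL; case: ifP; [lia | case: ifP; lia].
Qed.

(* All the removed cells are in the last column: slice [2 t + 1] loses a cell
   if [C t], and slice [2 t + 2] loses one, of the other colour, if [U t]. *)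
Definition punctured (C U : pred nat) i j :=
  (j == T.*2) && (if odd i then C i./2 else (0 < i) && U i./2.-1).

(** Here [e t] is the state between slices [2 t] and [2 t + 1]: removing a cell from slice [2 t + 1]
    raises it by one, removing a cell from slice [2 t + 2] lowers it by one. It starts at 1, since
    slice 0 has an odd number of cells, and ends at 0, since no slice follows the last one. *)
Lemma punctured_grid (e : nat -> nat) (C U : pred nat) :
  e 0 = 1 -> e T = 0 ->
  (forall t, t < T -> e t.+1 + U t = e t + C t /\ ~~ (C t && U t)) ->
  tileable (region (fun i j => ~~ punctured C U i j)).
Proof.
move=> e0 eT eS.
(* Hence [e t <= T] for [t < T]: the even columns matched vertically stay away from column [2 T],
   where cells are removed. *)
have e_le t : t <= T -> e t <= t.+1.
  elim: t => [|t IH] tT; first by rewrite e0.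
  by have [] := eS _ tT; have := IH (ltnW tT); case: (C t); lia.
have labelE (c b : bool) (m n t : nat) :
    ((if c then (m, true) else (n, false)) == (t, b)) =
      if b then c && (m == t) else ~~ c && (n == t).
  by case: c; case: b; rewrite xpair_eqE ?andbF ?andbT.
(* Label [(t, true)]: the even columns matched between slices [2 t] and [2 t + 1]. Label
   [(t + 1, false)]: what remains of slices [2 t + 1] and [2 t + 2]. Label [(0, false)]: what
   remains of slice 0. *)
apply: (@region_fibers _ (fun i j =>
  if low_even (e i./2) j then (i./2, true) else (i./2 + odd i, false))).
move=> [t []].
  case: (ltnP t T) => tT.
    rewrite (@eq_region _ (fun i j =>
      ((i == t.*2) || (i == t.*2.+1)) && low_even (e t) j)).
      by apply: vertical_region; lia.
    move=> i j iL jL; rewrite labelE.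
    have [ti|] := eqVneq i./2 t; last by lia.
    have := e_le t (ltnW tT).
    by rewrite ti andbT /low_even /punctured => et; case: (odd i); lia.
  apply: region0 => i j iL jL; rewrite labelE.
  have [ti|] := eqVneq i./2 t; last by rewrite !andbF.
  have -> : i./2 = T by lia.
  by rewrite eT /low_even ltn0 !andbF.
case: t => [|t].
  rewrite (@eq_region _ (fun i j => (i == 0) && (1 <= j < 1 + T.*2))).
    by apply: horizontal_region; lia.
  move=> i j iL jL; rewrite labelE /punctured.
  by case: (i =P 0) => [->|] /=; rewrite ?e0 /low_even; lia.
case: (ltnP t T) => tT; last first.
  by apply: region0 => i j iL jL; rewrite labelE; lia.
have [eSt CUt] := eS _ tT.
have halves i : (i./2 + odd i == t.+1) = (i == t.*2.+1) || (i == t.+1.*2) by lia.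
pose R c u i j := (i == t.*2.+1) && ~~ low_even (e t) j && ~~ (c && (j == T.*2))
  || (i == t.+1.*2) && ~~ low_even (e t.+1) j && ~~ (u && (j == T.*2)).
rewrite (@eq_region _ (R (C t) (U t))); last first.
  move=> i j iL jL; rewrite /R.
  have half1 : t.*2.+1./2 = t by lia.
  have half2 : t.+1.*2./2 = t.+1 by lia.
  rewrite labelE halves /punctured; case: (eqVneq i t.*2.+1) => [->|_].
    have -> : (t.*2.+1 == t.+1.*2) = false by lia.
    by rewrite half1 oddS odd_double !andTb andbT orbF andbC (andbC (C t)).
  case: (eqVneq i t.+1.*2) => [->|_]; last by rewrite !andbF.
  by rewrite half2 odd_double !andTb andbT andbC (andbC (U t)).
have := e_le t (ltnW tT).
(* If one cell is removed, its slice plays the role of [a] in [swap_region]; if none is, the two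
   slices have the same remaining columns and are matched vertically. *)
move: CUt eSt; case: (C t); case: (U t) => //= _ eSt et.
- rewrite (@eq_region _ (fun i j => (i == t.*2.+1) && ~~ low_even (e t) j && (j != T.*2)
                            || (i == t.+1.*2) && ~~ low_even (e t).+1 j)).
    by apply: (@swap_region t.*2.+1); lia.
  by move=> i j _ _; rewrite /R /= andbT (_ : e t.+1 = (e t).+1) //; lia.
- rewrite (@eq_region _ (fun i j =>
    (i == t.+1.*2) && ~~ low_even (e t.+1) j && (j != T.*2)
     || (i == t.*2.+1) && ~~ low_even (e t.+1).+1 j)).
    by apply: (@swap_region t.*2.+1); lia.
  by move=> i j _ _; rewrite /R /= andbT orbC (_ : e t = (e t.+1).+1) //; lia.
- rewrite (@eq_region _ (fun i j =>
    ((i == t.*2.+1) || (i == t.*2.+2)) && ~~ low_even (e t) j)).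
    by apply: vertical_region; lia.
  move=> i j _ _; have eS1 : e t.+1 = e t by lia.
  by rewrite /R eS1 /= !andbT -andb_orl.
Qed.

End Grid.

Definition cover_count (X : finType) (As : seq {set X}) (x : X) :=
  count (fun A : {set X} => x \in A) As.

(** A grid of odd side has one more cell of the colour of its corners; over each [x], one more cell
    of that colour is removed than of the other, by the hypothesis on [cover_count]. *)
Lemma tileable_grid_prod (V W X : tspace) (k : V -> nat) (l : W -> nat) T
    (As Bs : seq {set X}) :
  cell_path k T.*2.+1 -> cell_path l T.*2.+1 ->
  {in As, forall A, tileable A} -> {in Bs, forall B, tileable B} ->
  (forall x, cover_count As x = (cover_count Bs x).+1) ->
  size As + size Bs <= T ->
  @tileable (tprod (tprod V W) X)
    [set z | (k z.1.1 < T.*2.+1) && (l z.1.2 < T.*2.+1)].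
Proof.
move=> k_path l_path tAs tBs cnt szT; set L := T.*2.+1 in k_path l_path *.
pose J := size Bs.
pose C t := nth set0 Bs t.
pose U t := if t < J then set0 else nth set0 As (t - J).
have tC t : tileable (C t).
  rewrite /C; case: (ltnP t J) => tJ; first by apply/tBs/mem_nth.
  by rewrite nth_default //; apply: tileable0.
have tU t : tileable (U t).
  rewrite /U; case: ltnP => _; first exact: tileable0.
  case: (ltnP (t - J) (size As)) => tJ; first by apply/tAs/mem_nth.
  by rewrite nth_default //; apply: tileable0.
pose D i := if odd i then C i./2 else if 0 < i then U i./2.-1 else set0.
have tD i : tileable (D i).
  rewrite /D; case: ifP => // _; case: ifP => // _; exact: tileable0.
(* All of [Bs] is removed first, which raises the state from 1 to
   [1 + cover_count Bs x = cover_count As x]; then [As] brings it down to 0. *)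
pose e x t := if t < J then (cover_count (take t Bs) x).+1
              else cover_count (drop (t - J) As) x.
have grid x : tileable (region k l T (fun i j =>
    ~~ punctured T (fun t => x \in C t) (fun t => x \in U t) i j)).
  apply: (@punctured_grid _ _ _ _ _ k_path l_path (e x)).
  - rewrite /e sub0n; case: ifP => J0; first by rewrite take0.
    by rewrite drop0 cnt /cover_count (size0nil (s := Bs)) //; lia.
  - by rewrite /e ifN ?drop_oversize //; lia.
  move=> t tT; rewrite /e /U; case: (ltnP t J) => tJ.
    rewrite inE andbF; split=> //.
    have takeS : cover_count (take t.+1 Bs) x =
        cover_count (take t Bs) x + (x \in C t).
      by rewrite (take_nth set0 tJ) /cover_count -cats1 count_cat /= addn0.
    case: ltnP => [_|tJ']; first by rewrite takeS; lia.
    have -> : t.+1 - J = 0 by lia.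
    rewrite drop0 cnt addn0 addSn -takeS take_oversize //.
  have -> : C t = set0 by rewrite /C nth_default.
  rewrite inE ifN; last by lia.
  split=> //; rewrite subSn //; set i := t - J.
  case: (ltnP i (size As)) => iA.
    by rewrite (drop_nth set0 iA) /cover_count /= addn0 addnC.
  by rewrite !drop_oversize ?nth_default ?inE //; lia.
(* Removed points are grouped by slice, to be tiled along [X]; the others are grouped by [x], to be
   tiled inside the grid. *)
pose f (z : tprod (tprod V W) X) : nat + X :=
  if (l z.1.2 == T.*2) && (z.2 \in D (k z.1.1)) then inl (k z.1.1) else inr z.2.
have puncE x i j : punctured T (fun t => x \in C t) (fun t => x \in U t) i j
    = (j == T.*2) && (x \in D i).
  by rewrite /punctured /D; case: (odd i) => //; case: (0 < i); rewrite ?inE.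
apply: (@tileable_fibers _ _ f) => -[i|x].
  case: (ltnP i L) => iL; last first.
    apply: tileable_empty => z; rewrite !inE /f; case: ifP => _; last by rewrite andbF.
    by apply/negP=> /andP[/andP[kL _] /eqP[ki]]; move: kL; rewrite ki ltnNge iL.
  rewrite (_ : [set _ in _ | _] =
    setX (setX [set v | k v == i] [set w | l w == T.*2]) (D i)).
    exact: (@tileable_setXr (tprod V W)).
  apply/setP=> -[[v w] x]; rewrite !inE /f /=.
  case: ifP => [/andP[/eqP -> xD]|nD] /=.
    rewrite (_ : inl _ == inl _ = (k v == i)) // ltnSn eqxx !andbT.
    by case: eqP xD => [->|]; rewrite ?andbF ?iL // => ->.
  by rewrite andbF; case: (k v =P i) nD => //= ->.
rewrite (_ : [set _ in _ | _] = setX (region k l T (fun i j =>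
    ~~ punctured T (fun t => x \in C t) (fun t => x \in U t) i j)) [set x]).
  exact: (@tileable_setXl (tprod V W)).
apply/setP=> -[[v w] y]; rewrite !inE /f /= puncE -/L.
case: (eqVneq y x) => [->|yx].
  by case: ifP => _; rewrite ?eqxx ?andbT ?andbF.
rewrite andbF; case: ifP => _; first by rewrite andbF.
by rewrite (_ : inr _ == inr _ = (y == x)) // (negbTE yx) andbF.
Qed.

(** * Merging the sets of a cover *)

Section Absorption.
Variable K : tspace -> Prop.
Hypothesis K_prod : forall V W, K V -> K W -> K (tprod V W).

(* The cells of [V] are [B \ A], [A & B] and [A \ B]; the path on [Y x V] runs
   through [Y] forwards, backwards and forwards. *)
Lemma power_cell_path (V : tspace) (A B : {set V}) (R : nat -> {set V}) p :
  K V -> tileable A -> tileable B -> (forall i, tileable (R i)) ->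
  (forall v, v \notin A -> v \notin B -> exists2 i, i < p & v \in R i) ->
  forall q, exists2 Y : tspace, K Y &
    exists (k : Y -> nat) (S : nat -> {set Y}),
      [/\ cell_path k (3 ^ q.+1), forall i, tileable (S i)
        & forall y, 3 ^ q.+1 <= k y -> exists2 i, i < p & y \in S i].
Proof.
move=> KV tA tB tR covV.
pose c (v : V) : nat := if v \in A then (if v \in B then 1 else 2)
                        else (if v \in B then 0 else 3).
have c01 : tileable [set v | (c v == 0) || (c v == 1)].
  rewrite (_ : [set _ | _] = B) //; apply/setP=> v; rewrite inE /c.
  by case: (v \in A) (v \in B) => -[].
have c12 : tileable [set v | (c v == 1) || (c v == 2)].
  rewrite (_ : [set _ | _] = A) //; apply/setP=> v; rewrite inE /c.
  by case: (v \in A) (v \in B) => -[].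
have c3 v : c v <= 3 by rewrite /c; case: ifP; case: ifP.
have covc v : 3 <= c v -> exists2 i, i < p & v \in R i.
  move=> cv; apply: covV; move: cv; rewrite /c; first by case: ifP; case: ifP.
  by case: ifP; case: ifP.
elim=> [|q [Y KY [k [S [k_path tS covY]]]]].
  exists V => //; exists c, R; split=> // -[|[|j]] //.
set L := 3 ^ q.+1 in k_path covY.
have L0 : 0 < L by rewrite expn_gt0.
(* The odd layer is run backwards. Points outside the path of [Y], or with [c z.2 = 3], get a value
   of at least [3 L], hence no cell. *)
pose k' (z : tprod Y V) := if k z.1 < L then
  L * c z.2 + (if odd (c z.2) then L.-1 - k z.1 else k z.1) else L * 3.
exists (tprod Y V); first exact: K_prod.
exists k', (fun i => [set z | (z.1 \in S i) || (z.2 \in R i)]).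
have -> : 3 ^ q.+2 = L * 3 by rewrite expnSr.
split.
- have layer s i (Q : {set V}) : s.+1 < L -> (forall z, (z \in Q) = (c z == i)) ->
    tileable [set z : tprod Y V | ((k z.1 == s) || (k z.1 == s.+1)) && (c z.2 == i)].
    move=> sL QE; rewrite (_ : [set _ | _] = setX [set y | (k y == s) || (k y == s.+1)] Q).
      exact/tileable_setXl/k_path.
    by apply/setP=> -[y v]; rewrite !inE /= QE.
  (* Five positions: inside layer 0, the turn at [L], inside layer 1, the turn at [2 L], inside
     layer 2. At a turn the cell of [Y] is fixed and the step is tiled along [V], by [B] at the
     first turn and by [A] at the second. *)
  move=> j jL.
  have [j1|j1] := ltnP j.+1 L.
    rewrite (_ : [set _ | _] =
      [set z : tprod Y V | ((k z.1 == j) || (k z.1 == j.+1)) && (c z.2 == 0)]).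
      by apply: (@layer _ _ [set v | c v == 0]) => // v; rewrite inE.
    apply/setP=> -[y v]; rewrite !inE /k' /=.
    by case: (c v) (c3 v) => [|[|[|[|]]]] //= _; case: ltnP; lia.
  have [j2|j2] := eqVneq j.+1 L.
    rewrite (_ : [set _ | _] =
      setX [set y | k y == j] [set v | (c v == 0) || (c v == 1)]).
      exact: tileable_setXr.
    apply/setP=> -[y v]; rewrite !inE /k' /=.
    by case: (c v) (c3 v) => [|[|[|[|]]]] //= _; case: ltnP; lia.
  have [j3|j3] := ltnP j.+1 (L * 2).
    rewrite (_ : [set _ | _] = [set z : tprod Y V |
        ((k z.1 == (L * 2 - j).-2) || (k z.1 == (L * 2 - j).-2.+1)) && (c z.2 == 1)]).
      by apply: (@layer _ _ [set v | c v == 1]) => [|v]; [lia | rewrite inE].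
    apply/setP=> -[y v]; rewrite !inE /k' /=.
    by case: (c v) (c3 v) => [|[|[|[|]]]] //= _; case: ltnP; lia.
  have [j4|j4] := eqVneq j.+1 (L * 2).
    rewrite (_ : [set _ | _] =
      setX [set y | k y == 0] [set v | (c v == 1) || (c v == 2)]).
      exact: tileable_setXr.
    apply/setP=> -[y v]; rewrite !inE /k' /=.
    by case: (c v) (c3 v) => [|[|[|[|]]]] //= _; case: ltnP; lia.
  rewrite (_ : [set _ | _] = [set z : tprod Y V |
      ((k z.1 == j - L * 2) || (k z.1 == (j - L * 2).+1)) && (c z.2 == 2)]).
    by apply: (@layer _ _ [set v | c v == 2]) => [|v]; [lia | rewrite inE].
  apply/setP=> -[y v]; rewrite !inE /k' /=.
  by case: (c v) (c3 v) => [|[|[|[|]]]] //= _; case: ltnP; lia.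
- by move=> i; apply: tileable_or.
move=> [y v]; rewrite /k' /=; case: ltnP => [kL|/covY[i ip yS] _]; last first.
  by exists i => //; rewrite inE /= yS.
move=> cv; have /covc[i ip vR] : 3 <= c v.
  by case: (c v) (c3 v) cv => [|[|[|[|]]]] //= _; lia.
by exists i => //; rewrite inE /= vR orbT.
Qed.

(** Induction on the size of the cover: [R 0] and [R 1] are replaced by a single grid, and the other
    sets are lifted without increasing their number. *)
Lemma absorption (X : tspace) (As Bs : seq {set X}) :
  K X -> {in As, forall A, tileable A} -> {in Bs, forall B, tileable B} ->
  (forall x, cover_count As x = (cover_count Bs x).+1) ->
  forall p (V : tspace) (R : nat -> {set V}), K V ->
    (forall i, tileable (R i)) -> (forall v, exists2 i, i <= p & v \in R i) ->
  exists2 Y : tspace, K Y & tileable [set: Y].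
Proof.
move=> KX tAs tBs cnt; elim=> [|p IH] V R KV tR covV.
  exists V => //; rewrite (_ : [set: V] = R 0) //.
  by apply/setP=> v; rewrite inE; have [[]// _ ->] := covV v.
have [|Y KY [k [S [k_path tS covY]]]] :=
    @power_cell_path V (R 0) (R 1) (fun i => R i.+2) p KV (tR 0) (tR 1)
      (fun i => tR i.+2) _ (size As + size Bs).
  by move=> v /negP v0 /negP v1; have [[|[|i]]] := covV v => //; exists i.
(* The path length [3 ^ q.+1] is odd, hence of the form [2 T + 1], and is large enough to give
   [q <= T]. *)
set q := _ + _ in k_path covY; pose T := (3 ^ q.+1)./2.
have LE : 3 ^ q.+1 = T.*2.+1 by rewrite -[LHS]odd_double_half oddX.
have qT : q <= T.
  suff: q.*2 < 3 ^ q.+1 by lia.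
  by elim: (q) => // i; rewrite (expnS 3 i.+1); lia.
rewrite LE in k_path covY.
pose R' i : {set tprod (tprod Y Y) X} :=
  if i is i'.+1 then setX [set z | (z.1 \in S i') || (z.2 \in S i')] [set: X]
  else [set z | (k z.1.1 < T.*2.+1) && (k z.1.2 < T.*2.+1)].
apply: (IH _ R'); first by do 2 apply: K_prod => //.
  case=> [|i]; first exact: (tileable_grid_prod k_path k_path tAs tBs cnt).
  exact: (@tileable_setXl (tprod Y Y) X _ _ (tileable_or (tS i) (tS i))).
move=> [[y y'] x].
have [ky|/covY[i ip yS]] := ltnP (k y) T.*2.+1; last first.
  by exists i.+1 => //; rewrite !inE /= yS.
have [ky'|/covY[i ip yS]] := ltnP (k y') T.*2.+1; last first.
  by exists i.+1 => //; rewrite !inE /= yS orbT.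
by exists 0 => //; rewrite !inE /= ky ky'.
Qed.

End Absorption.

(** * Integral combinations of tiles *)

(** Coefficients are encoded by repetition in the lists, positive ones in [As] and negative ones in
    [Bs]. *)
Definition spanned (X : tspace) (g : X -> int) := exists As Bs : seq {set X},
  [/\ {in As, forall A, tile A}, {in Bs, forall B, tile B}
    & forall x, g x = ((cover_count As x)%:Z - (cover_count Bs x)%:Z)%R].

Section Span.
Local Open Scope ring_scope.
Variable X : tspace.
Implicit Types f g : X -> int.

Lemma eq_spanned f g : f =1 g -> spanned f -> spanned g.
Proof.
by move=> fg [As [Bs [tA tB fE]]]; exists As, Bs; split=> // x; rewrite -fg.
Qed.

Lemma spanned0 : spanned (fun _ : X => 0).
Proof. by exists [::], [::]; split=> // x; rewrite subrr. Qed.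

Lemma spanned_tile (A : {set X}) : tile A -> spanned (fun x => (x \in A)%:Z).
Proof.
move=> tA; exists [:: A], [::]; split=> // [B|x]; first by rewrite inE => /eqP->.
by rewrite /cover_count /= addn0 subr0.
Qed.

Lemma spannedD f g : spanned f -> spanned g -> spanned (fun x => f x + g x).
Proof.
move=> [As [Bs [tA tB fE]]] [Cs [Ds [tC tD gE]]].
exists (As ++ Cs), (Bs ++ Ds); split=> [A|A|x].
- by rewrite mem_cat => /orP[/tA|/tC].
- by rewrite mem_cat => /orP[/tB|/tD].
- by rewrite fE gE /cover_count !count_cat !PoszD; ring.
Qed.

Lemma spannedN f : spanned f -> spanned (fun x => - f x).
Proof.
move=> [As [Bs [tA tB fE]]]; exists Bs, As; split=> // x.
by rewrite fE opprB.
Qed.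

Lemma spanned_sum (I : Type) (r : seq I) (f : I -> X -> int) :
  (forall i, spanned (f i)) -> spanned (fun x => \sum_(i <- r) f i x).
Proof.
move=> tf; elim: r => [|i r IH].
  by apply: eq_spanned spanned0 => x; rewrite big_nil.
by apply: eq_spanned (spannedD (tf i) IH) => x; rewrite big_cons.
Qed.

Lemma spannedZ (n : int) f : spanned f -> spanned (fun x => n * f x).
Proof.
move=> tf; have nat_mul (j : nat) : spanned (fun x => j%:Z * f x).
  elim: j => [|j IH]; first by apply: eq_spanned spanned0 => x; rewrite mul0r.
  by apply: eq_spanned (spannedD tf IH) => x; rewrite intS mulrDl mul1r.
case: n => j; first exact: nat_mul.
by apply: eq_spanned (spannedN (nat_mul j.+1)) => x; rewrite NegzE mulNr.
Qed.

End Span.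

Section SpanProd.
Local Open Scope ring_scope.
Variables X Y : tspace.

(** Write [u] as a combination of indicators of points: a tile times a point is a tile of the
    product. *)
Lemma spanned_prodl (g : X -> int) (u : Y -> int) :
  spanned g -> @spanned (tprod X Y) (fun z => g z.1 * u z.2).
Proof.
move=> [As [Bs [tA tB gE]]].
have col (y : Y) : @spanned (tprod X Y) (fun z => u y * (g z.1 * (z.2 == y)%:Z)).
  apply: (@spannedZ (tprod X Y)).
  pose ext := map (fun A : {set X} => setX A [set y]).
  exists (ext As), (ext Bs); split=> [_ /mapP[A Ain ->]|_ /mapP[B Bin ->]|[x z] /=].
  - by left; exists A, y; split=> //; apply: tA.
  - by left; exists B, y; split=> //; apply: tB.
  have cntE (Cs : seq {set X}) :
      cover_count (ext Cs) (x, z) = (cover_count Cs x * (z == y))%N.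
    rewrite /cover_count count_map.
    rewrite (@eq_count _ _ (fun C : {set X} => (x \in C) && (z == y))); last first.
      by move=> C; rewrite /= !inE.
    case: (z == y); rewrite ?muln1 ?muln0.
      by apply: eq_count => C; rewrite andbT.
    by rewrite -[RHS](count_pred0 Cs); apply: eq_count => C; rewrite andbF.
  by rewrite !cntE gE !PoszM mulrBl.
apply: eq_spanned (spanned_sum (index_enum Y) col) => -[x z] /=.
rewrite (bigD1 z) //= eqxx mulr1 mulrC big1 ?addr0 // => y yz.
by rewrite eq_sym (negbTE yz) !mulr0.
Qed.

Lemma spanned_prodr (u : X -> int) (g : Y -> int) :
  spanned g -> @spanned (tprod X Y) (fun z => u z.1 * g z.2).
Proof.
move=> [As [Bs [tA tB gE]]].
have row (x : X) : @spanned (tprod X Y) (fun z => u x * (g z.2 * (z.1 == x)%:Z)).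
  apply: (@spannedZ (tprod X Y)).
  pose ext := map (fun A : {set Y} => setX [set x] A).
  exists (ext As), (ext Bs); split=> [_ /mapP[A Ain ->]|_ /mapP[B Bin ->]|[z y] /=].
  - by right; exists x, A; split=> //; apply: tA.
  - by right; exists x, B; split=> //; apply: tB.
  have cntE (Cs : seq {set Y}) :
      cover_count (ext Cs) (z, y) = (cover_count Cs y * (z == x))%N.
    rewrite /cover_count count_map.
    rewrite (@eq_count _ _ (fun C : {set Y} => (y \in C) && (z == x))); last first.
      by move=> C; rewrite /= !inE andbC.
    case: (z == x); rewrite ?muln1 ?muln0.
      by apply: eq_count => C; rewrite andbT.
    by rewrite -[RHS](count_pred0 Cs); apply: eq_count => C; rewrite andbF.
  by rewrite !cntE gE !PoszM mulrBl.
apply: eq_spanned (spanned_sum (index_enum X) row) => -[z y] /=.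
rewrite (bigD1 z) //= eqxx mulr1 big1 ?addr0 // => x xz.
by rewrite eq_sym (negbTE xz) !mulr0.
Qed.

End SpanProd.

Definition spans_one_mod (e : nat) (X : tspace) :=
  exists u : X -> int, spanned (fun x => 1 - e%:Z * u x)%R.

(* [1 (x) 1 = s (x) 1 + e u (x) 1 = s (x) 1 + e u (x) s' + e e' u (x) u'] *)
Lemma spans_one_modM (e e' : nat) (X Y : tspace) :
  spans_one_mod e X -> spans_one_mod e' Y ->
  spans_one_mod (e * e') (tprod X Y).
Proof.
move=> [u su] [u' su']; exists (fun z => u z.1 * u' z.2)%R.
have := spannedD (spanned_prodl (fun=> 1%R) su)
                 (spanned_prodr (fun x => e%:Z * u x)%R su').
by apply: eq_spanned => z; rewrite PoszM; ring.
Qed.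

Section SpanOne.
Variable K : tspace -> Prop.
Hypothesis K_prod : forall V W, K V -> K W -> K (tprod V W).

Lemma spans_one_mod_primes (S : tspace) (e : nat) : K S -> 0 < e ->
  (forall p, prime p -> p %| e -> spans_one_mod p S) ->
  exists2 X, K X & spans_one_mod e X.
Proof.
move=> KS; elim/ltn_ind: e => e IH e0 sp.
have [e1|e1] := leqP e 1.
  have -> : e = 1 by lia.
  exists S => //; exists (fun=> 1%R).
  by apply: eq_spanned (spanned0 S) => x; rewrite mulr1 subrr.
have p_pr := pdiv_prime e1; have p_dv := pdiv_dvd e.
have [] := IH (e %/ pdiv e).
- by rewrite ltn_Pdiv ?prime_gt1.
- by rewrite divn_gt0 ?prime_gt0 // dvdn_leq.
- move=> p pp pe; apply: sp => //; apply: dvdn_trans pe _.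
  by apply/dvdnP; exists (pdiv e); rewrite mulnC divnK.
move=> X KX sX; exists (tprod X S); first exact: K_prod.
suff: spans_one_mod (e %/ pdiv e * pdiv e) (tprod X S) by rewrite divnK.
by apply: spans_one_modM => //; apply: sp.
Qed.

(** [1 = (1 - h u) (x) 1 + u (x) h], where both terms are spanned. *)
Lemma spanned_one (S : tspace) (h : nat) : K S -> 0 < h ->
  spanned (fun _ : S => h%:Z%R) ->
  (forall p, prime p -> p %| h -> spans_one_mod p S) ->
  exists (X : tspace) (As Bs : seq {set X}), [/\ K X,
    {in As, forall A, tileable A}, {in Bs, forall B, tileable B}
    & forall x, cover_count As x = (cover_count Bs x).+1].
Proof.
move=> KS h0 sh sp; have [X KX [u su]] := spans_one_mod_primes KS h0 sp.
have [As [Bs [tA tB E]]] : @spanned (tprod X S) (fun=> 1%R).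
  have := spannedD (spanned_prodl (fun=> 1%R) su) (spanned_prodr u sh).
  by apply: eq_spanned => z; ring.
exists (tprod X S), As, Bs; split.
- exact: K_prod.
- by move=> A /tA; apply: tileable_tile.
- by move=> B /tB; apply: tileable_tile.
- by move=> z; have := E z; lia.
Qed.

End SpanOne.

(** * Shift-invariant spaces of functions modulo a prime *)

Section Update.
Variables (d : nat) (A : Type).
Implicit Types (x : {ffun 'I_d -> A}) (i j : 'I_d) (a b : A).

Definition upd x i a : {ffun 'I_d -> A} := [ffun j => if j == i then a else x j].

Lemma upd_same x i a : upd x i a i = a.
Proof. by rewrite ffunE eqxx. Qed.

Lemma upd_other x i j a : j != i -> upd x i a j = x j.
Proof. by move=> ji; rewrite ffunE (negbTE ji). Qed.

Lemma upd_upd x i a b : upd (upd x i a) i b = upd x i b.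
Proof. by apply/ffunP=> j; rewrite !ffunE; case: eqP. Qed.

Lemma upd_comm x i j a b : i != j ->
  upd (upd x i a) j b = upd (upd x j b) i a.
Proof.
move=> ij; apply/ffunP=> l; rewrite !ffunE.
by case: (l =P j) => // ->; rewrite eq_sym (negbTE ij).
Qed.

Lemma upd_id x i : upd x i (x i) = x.
Proof. by apply/ffunP=> j; rewrite ffunE; case: eqP => [->|]. Qed.

End Update.

Section ShiftInvariant.
Local Open Scope ring_scope.
Variables (k d p : nat).
Hypothesis p_pr : prime p.
Hypothesis p_dvd : (p %| k.+2)%N.

Let X := {ffun 'I_d -> 'I_k.+2}.

Definition shift (i : 'I_d) (a : 'I_k.+2) (x : X) : X := upd x i (x i + a).

Lemma natr_ord (a b : 'I_k.+2) : ((a + b)%R : nat)%:R = a%:R + b%:R :> 'F_p.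
Proof.
have k0 : k.+2%:R = 0 :> 'F_p.
  by have /dvdnP[q ->] := p_dvd; rewrite natrM pchar_Fp_0 ?mulr0.
rewrite -natrD [in RHS](divn_eq (a + b) k.+2) natrD natrM k0 mulr0 add0r //.
Qed.

(** A shift-invariant linear space of functions, later the reductions modulo [p] of the spanned
    functions. *)
Variable M : (X -> 'F_p) -> Prop.
Hypothesis M_ext : forall f g, f =1 g -> M f -> M g.
Hypothesis M_zero : M (fun=> 0).
Hypothesis M_add : forall f g, M f -> M g -> M (fun x => f x + g x).
Hypothesis M_scale : forall c f, M f -> M (fun x => c * f x).
Hypothesis M_shift : forall i a f, M f -> M (fun x => f (shift i a x)).

Lemma M_sum (I : finType) (F : I -> X -> 'F_p) :
  (forall i, M (F i)) -> M (fun x => \sum_i F i x).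
Proof.
move=> MF; elim: (index_enum I) => [|i r IH].
  by apply: M_ext M_zero => x; rewrite big_nil.
by apply: M_ext (M_add (MF i) IH) => x; rewrite big_cons.
Qed.

(* If [f = f0 + f1] in the [i]-th coordinate, with [f0] on [x i = 0] and [f1]
   on [x i = 1], then averaging over this coordinate yields [f0 + f1], unless
   [f1 = - f0]; in this case weighting the translate by [a] with [a] itself,
   which makes sense modulo [p] because [p] divides the length of the cycle,
   yields [f0]. *)
Lemma flatten_coordinate (i : 'I_d) (f : X -> 'F_p) : M f ->
  (forall x, f x != 0 -> (x i <= 1)%N) -> (exists x, f x != 0) ->
  exists c0 c1 : 'F_p, let g x := c0 * f (upd x i 0) + c1 * f (upd x i 1) in
    M g /\ exists x, g x != 0.
Proof.
move=> Mf f01 [x0 fx0].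
have f_sum (w : 'I_k.+2 -> 'F_p) x :
    \sum_b w b * f (upd x i b) = w 0 * f (upd x i 0) + w 1 * f (upd x i 1).
  rewrite (bigD1 0) //= (bigD1 1) //= big1 ?addr0 // => b /andP[b0 b1].
  have [->|/f01] := eqVneq (f (upd x i b)) 0; first by rewrite mulr0.
  by rewrite upd_same; move: b0 b1; rewrite -!val_eqE /= modn_small //; lia.
have x0E : f (upd x0 i 0) != 0 \/ f (upd x0 i 1) != 0.
  have /f01 := fx0; case: (x0 i) (upd_id x0 i) => -[|[|b]] //= bk x0E _.
    left; rewrite (_ : 0 = Ordinal bk) ?x0E //; exact: val_inj.
  right; rewrite (_ : 1 = Ordinal bk) ?x0E //; exact: val_inj.
have [/existsP[x gx]|/existsPn f0N] :=
    boolP [exists x : X, f (upd x i 0) + f (upd x i 1) != 0].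
  exists 1, 1; split; last by exists x; rewrite !mul1r.
  apply: (M_ext _ (M_sum (fun a => M_shift i a Mf))) => y.
  rewrite -(f_sum (fun=> 1)) [RHS](reindex_inj (addrI (y i))) /=.
  by apply: eq_bigr => a _; rewrite mul1r.
have f1E x : f (upd x i 1) = - f (upd x i 0).
  by apply/eqP; rewrite -addr_eq0 addrC; have := f0N x; rewrite negbK.
exists 1, 0; split; last first.
  exists x0; rewrite mul1r mul0r addr0.
  by case: x0E => //; rewrite f1E oppr_eq0.
have := M_sum (fun a : 'I_k.+2 => M_scale ((a : nat)%:R) (M_shift i (- a) Mf)).
apply: M_ext => y; rewrite mul1r mul0r addr0.
(* With [b = y i - a], only [b = 0] and [b = 1] contribute. Their weights [y i] and [y i - 1] differ
   by 1 in ['F_p], and the two values of [f] are opposite, so the sum is the value at 0. *)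
transitivity (\sum_b ((y i - b)%R : nat)%:R * f (upd y i b)).
  rewrite [RHS](reindex_inj (inj_comp (addrI (y i)) oppr_inj)).
  apply: eq_bigr => a _; rewrite /shift /comp.
  by have -> : y i - (y i - a) = a by rewrite opprB addrC subrK.
rewrite (f_sum (fun b => ((y i - b)%R : nat)%:R)) f1E subr0.
have -> : (y i : nat)%:R = ((y i - 1)%R : nat)%:R + 1 :> 'F_p.
  by have := natr_ord (y i - 1) 1; rewrite subrK => ->; congr (_ + _); rewrite /= modn_small.
by ring.
Qed.

(** Flattening the coordinates one by one keeps the function nonzero and ends with a nonzero
    constant, which is invertible in ['F_p]. *)
Lemma shift_invariant_const f : M f ->
  (forall x (i : 'I_d), f x != 0 -> (x i <= 1)%N) -> (exists x, f x != 0) ->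
  M (fun=> 1).
Proof.
move=> Mf f01 f_n0.
have [g [Mg gC [x gx]]] : exists g, [/\ M g,
    forall x (i : 'I_d) a, (i < d)%N -> g (upd x i a) = g x & exists x, g x != 0].
  have : (d <= d)%N by [].
  (* The first [c] coordinates no longer matter; the support is still within [{0,1}] in the
     others. *)
  suff: forall c, (c <= d)%N -> exists g, [/\ M g,
      forall x (i : 'I_d) a, (i < c)%N -> g (upd x i a) = g x,
      forall x (i : 'I_d), (c <= i)%N -> g x != 0 -> (x i <= 1)%N & exists x, g x != 0].
    by move=> H /H[g [? ? _ ?]]; exists g.
  elim=> [_|c IH cd]; first by exists f; split=> // x i _; apply: f01.
  have [g [Mg gC g01 g_n0]] := IH (ltnW cd).
  pose i := Ordinal cd.
  have [|c0 [c1 [Mh h_n0]]] := @flatten_coordinate i g Mg _ g_n0.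
    by move=> x; apply: g01.
  set h := fun x => _ in Mh h_n0; exists h; split=> // [x j a|x j cj].
    rewrite ltnS leq_eqVlt => /orP[/eqP ji|jc].
      have -> : j = i by apply: val_inj.
      by rewrite /h !upd_upd.
    have ji : j != i by rewrite -val_eqE /= ltn_eqF.
    by rewrite /h !(upd_comm _ _ _ ji) !(gC _ j).
  have ji : j != i by rewrite -val_eqE /= gtn_eqF.
  rewrite /h => hx.
  have [/g01|/g01] : g (upd x i 0) != 0 \/ g (upd x i 1) != 0.
  - apply/orP; rewrite -negb_and; apply: contra hx => /andP[/eqP-> /eqP->].
    by rewrite !mulr0 addr0.
  - by move=> /(_ j (ltnW cj)); rewrite upd_other.
  - by move=> /(_ j (ltnW cj)); rewrite upd_other.
have g_const y : g y = g x.
  (* Go from [x] to [y] by changing one coordinate at a time. *)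
  pose mix n : X := [ffun j : 'I_d => if (j < n)%N then y j else x j].
  have mixC n : g (mix n) = g x.
    elim: n => [|n IH]; first by congr g; apply/ffunP=> j; rewrite ffunE.
    case: (ltnP n d) => nd; last first.
      rewrite -IH; congr g; apply/ffunP=> j; rewrite !ffunE.
      have jn : (j < n)%N by apply: leq_trans nd.
      by rewrite jn ltnS ltnW.
    rewrite -IH -(gC (mix n) (Ordinal nd) (y (Ordinal nd))) //.
    congr g; apply/ffunP=> j; rewrite !ffunE.
    have [->|/negbTE jn] := eqVneq j (Ordinal nd); first by rewrite /= ltnSn.
    by move: jn; rewrite -val_eqE /= ltnS leq_eqVlt => ->.
  by rewrite -(mixC d); congr g; apply/ffunP=> j; rewrite ffunE ltn_ord.
by apply: M_ext (M_scale (g x)^-1 Mg) => y; rewrite g_const mulVf.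
Qed.

End ShiftInvariant.

(** * Induced copies and induced subgraphs *)

Section InducedCopies.
Variables (G0 : sgraph) (V0 : {set G0}).

Definition induced_copy (G : sgraph) (X : {set G}) := exists f : G0 -> G,
  [/\ {in V0 &, injective f}, X = f @: V0
    & {in V0 &, forall u v, adj (f u) (f v) = adj u v}].

Lemma induced_copy_imset (G G' : sgraph) (g : G -> G') (X : {set G}) :
  injective g -> (forall u v, adj (g u) (g v) = adj u v) ->
  induced_copy X -> induced_copy (g @: X).
Proof.
move=> g_inj g_adj [f [f_inj -> f_adj]]; exists (g \o f); split.
- by move=> u v uV vV /g_inj; apply: f_inj.
- by rewrite imset_comp.
- by move=> u v uV vV; rewrite /= g_adj f_adj.
Qed.

End InducedCopies.

Lemma tileable_imset (V W : tspace) (f : V -> W) (X : {set V}) :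
  injective f -> (forall A : {set V}, tile A -> tile (f @: A)) ->
  tileable X -> tileable (f @: X).
Proof.
move=> f_inj f_tile; elim=> [|A Y tA _ IH dAY].
  by rewrite imset0; apply: tileable0.
rewrite imsetU; apply: tileable_add => //; first exact: f_tile.
by rewrite -setI_eq0 -imsetI ?(disjoint_setI0 dAY) ?imset0 // => u v _ _ /f_inj.
Qed.

Lemma tileable_partition (V : tspace) (X : {set V}) : tileable X ->
  exists P : {set {set V}}, [/\ {in P, forall A : {set V}, tile A},
    {in P &, forall A B : {set V}, A != B -> [disjoint A & B]} & cover P = X].
Proof.
elim=> [|A Y tA _ [P [tP dP PY]] dAY].
  exists set0; split=> [A|A B|]; rewrite ?inE //.
  by rewrite /cover big_set0.
have dA B : B \in P -> [disjoint A & B].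
  by move=> BP; apply: disjointWr dAY; rewrite -PY; apply: bigcup_sup.
exists (A |: P); split.
- by move=> B; rewrite !inE => /orP[/eqP->|/tP].
- move=> B C; rewrite !inE => /orP[/eqP->|BP] /orP[/eqP->|CP]; rewrite ?eqxx //.
  + by move=> _; apply: dA.
  + by move=> _; rewrite disjoint_sym; apply: dA.
  + exact: dP.
- by rewrite /cover bigcup_setU big_set1 -PY.
Qed.

Section InducedSubgraph.
Variable G : sgraph.

Lemma set2_edges (x y : G) : ([set x; y] \in edges G) = adj x y.
Proof.
apply/idP/idP; last first.
  by move=> xy; rewrite inE; apply/existsP; exists x; apply/existsP; exists y;
     rewrite xy eqxx.
rewrite inE => /existsP[u /existsP[v /andP[uv /eqP E]]].
have: u \in [set x; y] by rewrite E set21.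
have: v \in [set x; y] by rewrite E set22.
rewrite !inE => /orP[] /eqP vE /orP[] /eqP uE; move: uv; rewrite vE uE //.
- by rewrite adj_irrefl.
- by rewrite adj_sym.
- by rewrite adj_irrefl.
Qed.

Lemma induced_is_subgraph (X : {set G}) :
  is_subgraph (X, [set e in edges G | e \subset X]).
Proof.
apply/andP; split; first by apply/subsetP=> e; rewrite inE => /andP[].
by apply/forall_inP=> e; rewrite inE => /andP[].
Qed.

Definition induced_subgraph (X : {set G}) : subgraph G :=
  Sub (X, [set e in edges G | e \subset X]) (induced_is_subgraph X).

Lemma sub_vertices_induced X : sub_vertices (induced_subgraph X) = X.
Proof. by []. Qed.

Lemma induced_induced_subgraph X : induced (induced_subgraph X).
Proof. exact: eqxx. Qed.

Lemma induced_sub_adj (K : subgraph G) (u v : graph_of_subgraph K) :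
  induced K -> adj u v = adj (val u) (val v).
Proof.
move=> /eqP KE; rewrite -[LHS]/([set val u; val v] \in sub_edges K) KE inE.
rewrite set2_edges subUset !sub1set (valP u) (valP v) !andbT //.
Qed.

End InducedSubgraph.

Lemma induced_copy_iso (G0 G : sgraph) (H : subgraph G0) (X : {set G}) :
  induced H -> induced_copy (sub_vertices H) X ->
  graph_iso (graph_of_subgraph (induced_subgraph X)) (graph_of_subgraph H).
Proof.
move=> iH [f [f_inj XE f_adj]].
have fX (u : graph_of_subgraph H) : f (val u) \in sub_vertices (induced_subgraph X).
  by rewrite sub_vertices_induced XE imset_f // (valP u).
pose g u : graph_of_subgraph (induced_subgraph X) := Sub (f (val u)) (fX u).
have g_inj : injective g.
  by move=> u v [] /f_inj E; apply/val_inj/E; apply: valP.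
have [|h gh hg] := inj_card_bij g_inj.
  rewrite !card_sig sub_vertices_induced XE card_in_imset //.
exists h; first by exists g.
move=> x y; rewrite -{2}(hg x) -{2}(hg y) !induced_sub_adj //; last exact: eqxx.
by rewrite /= f_adj //; apply: valP.
Qed.

(** * Tori, their products and their tiles *)

Definition cycle_adj k (a b : 'I_k) :=
  (a != b) && ((a == b + 1 %[mod k]) || (b == a + 1 %[mod k])).

Lemma torus_adjP k n (u v : torus k n) :
  reflect (exists2 i, cycle_adj (u i) (v i) & forall j, j != i -> u j = v j)
          (adj u v).
Proof.
apply: (iffP existsP) => -[i].
  move=> /andP[/forallP uv c]; exists i; last first.
    by move=> j ji; have := uv j; rewrite (negbTE ji) => /eqP/negbFE/eqP.
  by rewrite /cycle_adj c andbT; have := uv i; rewrite eqxx => /eqP.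
move=> /andP[uv c] E; exists i; rewrite c andbT; apply/forallP=> j.
by have [->|/E ->] := eqVneq j i; [rewrite uv | rewrite eqxx].
Qed.

Section Join.
Variables k a b : nat.

Definition join (u : torus k a) (v : torus k b) : torus k (a + b) :=
  [ffun i => match split i with inl j => u j | inr j => v j end].

Lemma join_lshift u v i : join u v (lshift b i) = u i.
Proof. by rewrite ffunE (unsplitK (inl _ i)). Qed.

Lemma join_rshift u v i : join u v (rshift a i) = v i.
Proof. by rewrite ffunE (unsplitK (inr _ i)). Qed.

Lemma join_bij : bijective (fun z : torus k a * torus k b => join z.1 z.2).
Proof.
exists (fun w : torus k (a + b) =>
  ([ffun i => w (lshift b i)] : torus k a,
   [ffun i => w (rshift a i)] : torus k b)).
  by move=> [u v] /=; congr pair; apply/ffunP=> i;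
     rewrite ffunE ?join_lshift ?join_rshift.
move=> w; apply/ffunP=> i; rewrite ffunE /=.
by case: split_ordP => j ->; rewrite ffunE.
Qed.

Lemma join_adjl u u' v : adj (join u v) (join u' v) = adj u u'.
Proof.
apply/torus_adjP/torus_adjP=> -[i c E].
  case: (split_ordP i) c E => j -> c E; last first.
    by move: c; rewrite !join_rshift /cycle_adj eqxx.
  exists j; first by move: c; rewrite !join_lshift.
  move=> j' j'j; have := E (lshift b j'); rewrite !join_lshift; apply.
  by rewrite (inj_eq (@lshift_inj _ _)).
exists (lshift b i); rewrite ?join_lshift // => j.
case: (split_ordP j) => j' ->; rewrite ?join_rshift // !join_lshift.
by rewrite (inj_eq (@lshift_inj _ _)); apply: E.
Qed.

Lemma join_adjr u v v' : adj (join u v) (join u v') = adj v v'.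
Proof.
apply/torus_adjP/torus_adjP=> -[i c E].
  case: (split_ordP i) c E => j -> c E.
    by move: c; rewrite !join_lshift /cycle_adj eqxx.
  exists j; first by move: c; rewrite !join_rshift.
  move=> j' j'j; have := E (rshift a j'); rewrite !join_rshift; apply.
  by rewrite (inj_eq (@rshift_inj _ _)).
exists (rshift a i); rewrite ?join_rshift // => j.
case: (split_ordP j) => j' ->; rewrite ?join_lshift // !join_rshift.
by rewrite (inj_eq (@rshift_inj _ _)); apply: E.
Qed.

End Join.

Section TorusTiles.
Variables (k : nat) (G0 : sgraph) (V0 : {set G0}).

Definition torus_space n : tspace :=
  @TSpace (torus k n) (@induced_copy G0 V0 (torus k n)).

(** A product of tori is a torus only up to [join]; this class, closed under [tprod], is the [K] of
    the abstract results. *)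
Definition toroidal (V : tspace) := exists n (f : V -> torus_space n),
  bijective f /\ forall A : {set V}, tile A -> tile (f @: A).

Lemma toroidal_torus n : toroidal (torus_space n).
Proof.
exists n, id; split=> [|A tA]; first by exists id.
by rewrite imset_id.
Qed.

Lemma join_tile a b (X : {set torus k a * torus k b}) :
  @tile (tprod (torus_space a) (torus_space b)) X ->
  @tile (torus_space (a + b)) [set join z.1 z.2 | z in X].
Proof.
have join_inj := bij_inj (@join_bij k a b).
case=> [[A [w [tA ->]]]|[v [B [tB ->]]]].
  rewrite (_ : [set _ | _ in _] = [set join u w | u in A]).
    apply: induced_copy_imset tA => [u u' E|u v]; last exact: join_adjl.
    by have [] := join_inj (u, w) (u', w) E.
  apply/setP=> x; apply/imsetP/imsetP=> [[[u w'] /=]|[u uA ->]].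
    by rewrite !inE /= => /andP[uA /eqP-> ->]; exists u.
  by exists (u, w); rewrite // !inE /= uA eqxx.
rewrite (_ : [set _ | _ in _] = [set join v u | u in B]).
  apply: induced_copy_imset tB => [u u' E|u u']; last exact: join_adjr.
  by have [] := join_inj (v, u) (v, u') E.
apply/setP=> x; apply/imsetP/imsetP=> [[[v' u] /=]|[u uB ->]].
  by rewrite !inE /= => /andP[/eqP-> uB ->]; exists u.
by exists (v, u); rewrite // !inE /= uB eqxx.
Qed.

Lemma toroidal_prod V W : toroidal V -> toroidal W -> toroidal (tprod V W).
Proof.
move=> [a [f [f_bij tf]]] [b [g [g_bij tg]]].
pose fg (z : tprod V W) : tprod (torus_space a) (torus_space b) := (f z.1, g z.2).
exists (a + b), (fun z => join (fg z).1 (fg z).2); split.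
  apply: (bij_comp (@join_bij k a b)); have [f' f'K fK'] := f_bij.
  have [g' g'K gK'] := g_bij; exists (fun z => (f' z.1, g' z.2)) => -[x y] /=.
    by rewrite f'K g'K.
  by rewrite /fg /= fK' gK'.
move=> X tX.
rewrite (_ : [set _ | _ in _] = [set join z.1 z.2 | z in fg @: X]); last first.
  by rewrite -imset_comp.
apply: join_tile; case: tX => [[A [w [tA ->]]]|[v [B [tB ->]]]].
  left; exists (f @: A), (g w); split; first exact: tf.
  apply/setP=> -[x y]; rewrite !inE /=; apply/imsetP/andP.
    by case=> -[u w']; rewrite !inE /= => /andP[uA /eqP->] [-> ->]; rewrite imset_f.
  by case=> /imsetP[u uA ->] /eqP->; exists (u, w); rewrite // !inE /= uA eqxx.
right; exists (f v), (g @: B); split; first exact: tg.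
apply/setP=> -[x y]; rewrite !inE /=; apply/imsetP/andP.
  by case=> -[v' u]; rewrite !inE /= => /andP[/eqP-> uB] [-> ->]; rewrite imset_f.
by case=> /eqP-> /imsetP[u uB ->]; exists (v, u); rewrite // !inE /= uB eqxx.
Qed.

Lemma imset_bij_setT (V W : finType) (f : V -> W) :
  bijective f -> f @: [set: V] = [set: W].
Proof.
by case=> g _ gK; apply/setP=> w; rewrite inE -(gK w) imset_f // inE.
Qed.

(** A larger torus is a product with the tiled one as first factor, so each slice is tiled in the
    same way. *)
Lemma toroidal_tileable (Y : tspace) : toroidal Y -> tileable [set: Y] ->
  exists n0, forall n, n0 <= n -> tileable [set: torus_space n].
Proof.
move=> [n0 [f [f_bij tf]]] tY; exists n0 => n n0n; rewrite -(subnKC n0n).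
set b := n - n0.
have t0 : tileable [set: torus_space n0].
  rewrite -(imset_bij_setT f_bij); apply: tileable_imset => //; exact: bij_inj.
have tab : @tileable (tprod (torus_space n0) (torus_space b)) setT.
  rewrite (_ : setT = setX [set: torus_space n0] [set: torus_space b]).
    exact: tileable_setXl.
  by apply/setP=> z; rewrite !inE.
rewrite -(imset_bij_setT (@join_bij k n0 b)).
apply: (@tileable_imset (tprod (torus_space n0) (torus_space b))
          (torus_space (n0 + b))) => //.
  exact/bij_inj/join_bij.
by move=> A; apply: join_tile.
Qed.

End TorusTiles.

(** * Translations are automorphisms of the torus *)

Section Translations.
Local Open Scope ring_scope.
Variables (k d : nat).
Implicit Types u v g : torus k.+2 d.

Definition translate (g u : torus k.+2 d) : torus k.+2 d :=
  ((u : {ffun 'I_d -> 'I_k.+2}) + g)%R.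

Lemma cycle_adjD (a b c : 'I_k.+2) : cycle_adj (a + c) (b + c) = cycle_adj a b.
Proof.
have E (x y : 'I_k.+2) : ((x + c)%R == (y + c)%R + 1 %[mod k.+2])%N
    = (x == y + 1 %[mod k.+2])%N.
  by rewrite /= modn_mod modnDml addnAC eqn_modDr.
by rewrite /cycle_adj (inj_eq (addIr c)) !E.
Qed.

Lemma translate_inj g : injective (translate g).
Proof. exact: addIr. Qed.

Lemma translate_adj g u v : adj (translate g u) (translate g v) = adj u v.
Proof.
apply/torus_adjP/torus_adjP=> -[i c E]; exists i.
- by move: c; rewrite !ffunE cycle_adjD.
- by move=> j /E; rewrite !ffunE => /addIr.
- by rewrite !ffunE cycle_adjD.
- by move=> j /E; rewrite !ffunE => ->.
Qed.

End Translations.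

(** * An even cycle as an induced subgraph of a cube *)

(* The cycle of length [2 * l] goes around the [l]-dimensional cube: [l] steps
   up in each direction in turn, then [l] steps down. *)
Definition cycle_bit l a j := j < a <= j + l.

Section CycleBits.
Variable l : nat.

Lemma cycle_bit_inj a b : a < l.*2 -> b < l.*2 ->
  (forall j, j < l -> cycle_bit l a j = cycle_bit l b j) -> a = b.
Proof.
have lt_neq x y : x < y < l.*2 ->
    ~ (forall j, j < l -> cycle_bit l x j = cycle_bit l y j).
  rewrite /cycle_bit => xy E; have [xl|lx] := ltnP x l.
    have := E x xl; have [yx|xy'] := leqP y (x + l); first by lia.
    by have := E (y - l); lia.
  by have := E (x - l); lia.
move=> al bl E; have [ab|ba|//] := ltngtP a b; exfalso.
  by apply: (lt_neq a b) => //; rewrite ab.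
by apply: (lt_neq b a) => [|j jl]; rewrite ?ba // E.
Qed.

Lemma cycle_bitS a j : a.+1 < l.*2 -> j < l ->
  cycle_bit l a.+1 j (+) cycle_bit l a j = (j == if a < l then a else a - l).
Proof. by rewrite /cycle_bit => al jl; case: (ltnP a l); lia. Qed.

Lemma cycle_bit_last j : j < l ->
  cycle_bit l l.*2.-1 j (+) cycle_bit l 0 j = (j == l.-1).
Proof. rewrite /cycle_bit; lia. Qed.

(** The embedded cycle is induced: in each case below, two positions that are not consecutive on the
    cycle differ in the two bits that are examined. *)
Lemma adj_cycle_bit a b j : a < b < l.*2 ->
  (forall j', j' < l -> cycle_bit l a j' (+) cycle_bit l b j' = (j' == j)) ->
  b = a.+1 \/ a = 0 /\ b = l.*2.-1.
Proof.
rewrite /cycle_bit => ab E.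
have [bl|lb] := leqP b l.
  by have := E a; have := E a.+1; lia.
have [la|al] := leqP l a.
  by have := E (a - l); have := E (a - l).+1; lia.
have [a0|a0] := posnP a.
  by have := E l.-1; have := E l.-2; lia.
by have := E 0; have := E l.-1; lia.
Qed.

End CycleBits.

Section CubeEmbedding.
Variables k l m : nat.
Hypotheses (kl : k.+2 = l.*2) (l1 : 1 < l).

Lemma cycle_adj_sym (a b : 'I_k.+2) : cycle_adj a b = cycle_adj b a.
Proof. by rewrite /cycle_adj eq_sym orbC. Qed.

Lemma cycle_adj_lt (a b : 'I_k.+2) : a < b ->
  cycle_adj a b = (b == a.+1 :> nat) || (a == 0 :> nat) && (b == k.+1 :> nat).
Proof.
move=> ab; have bk := ltn_ord b.
have -> : cycle_adj a b = (a == b + 1 %[mod k.+2]) || (b == a + 1 %[mod k.+2]).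
  by rewrite /cycle_adj -val_eqE /= (ltn_eqF ab).
rewrite !addn1 (modn_small (ltn_ord a)) (modn_small bk) (@modn_small a.+1); last by lia.
have [bk1|kb1] := ltnP b.+1 k.+2; first by rewrite modn_small //; lia.
by rewrite (_ : b.+1 = k.+2) ?modnn; lia.
Qed.

Lemma cycle_adj_bits (a b : 'I_k.+2) : cycle_adj a b <->
  exists j : 'I_l, forall j' : 'I_l,
    cycle_bit l a j' (+) cycle_bit l b j' = (j' == j).
Proof.
have lt_case (x y : 'I_k.+2) : x < y -> cycle_adj x y <->
    exists j : 'I_l, forall j' : 'I_l,
      cycle_bit l x j' (+) cycle_bit l y j' = (j' == j).
  move=> xy; have yk := ltn_ord y; rewrite cycle_adj_lt //; split.
    move=> /orP[/eqP yE|/andP[/eqP xE /eqP yE]].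
      have jl : (if x < l then x : nat else x - l) < l by case: ifP; lia.
      exists (Ordinal jl) => j'; rewrite addbC yE cycle_bitS ?ltn_ord //.
      by lia.
    have jl : l.-1 < l by lia.
    exists (Ordinal jl) => j'; rewrite addbC xE yE (_ : k.+1 = l.*2.-1); last by lia.
    by rewrite cycle_bit_last ?ltn_ord.
  move=> [j E]; have [||yE|[xE yE]] := @adj_cycle_bit l x y j.
  - by rewrite xy; lia.
  - by move=> j' j'l; have := E (Ordinal j'l); rewrite -val_eqE.
  - by rewrite yE eqxx.
  - by rewrite xE yE; lia.
have [ab|ba|ab] := ltngtP a b; first exact: lt_case.
  rewrite cycle_adj_sym lt_case //.
  by split=> -[j E]; exists j => j'; rewrite addbC.
rewrite (val_inj ab); split; first by rewrite /cycle_adj eqxx.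
by move=> [j /(_ j)]; rewrite addbb eqxx.
Qed.

(** Bit [j] of the coordinate [u i] is stored at the rank of the pair [(i, j)], as the element 0 or
    1 of the cycle. *)
Definition cube_code (u : torus k.+2 m) : torus k.+2 #|{: 'I_m * 'I_l}| :=
  [ffun t : 'I_#|{: 'I_m * 'I_l}| =>
     inord (cycle_bit l (u (enum_val t).1) (enum_val t).2)].

Lemma cycle_adj_bool (b c : bool) :
  cycle_adj (inord b : 'I_k.+2) (inord c) = b (+) c.
Proof.
rewrite /cycle_adj -!val_eqE /= !inordK; [|by case: c|by case: b].
by case: b; case: c => //=; rewrite ?addn0 ?eqxx ?orbT.
Qed.

Lemma inord_bool_inj : injective (fun b : bool => inord b : 'I_k.+2).
Proof. by move=> b c /(congr1 val); rewrite /= !inordK; case: b; case: c. Qed.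

Lemma cube_code_bit u i j :
  cube_code u (enum_rank (i, j)) = inord (cycle_bit l (u i) j).
Proof. by rewrite ffunE enum_rankK. Qed.

Lemma cube_code_le1 u t : cube_code u t <= 1.
Proof. by rewrite ffunE inordK; case: cycle_bit. Qed.

Lemma cube_code_inj : injective cube_code.
Proof.
move=> u v uv; apply/ffunP=> i; apply: val_inj.
apply: (@cycle_bit_inj l); rewrite -?kl ?ltn_ord // => j jl.
apply: inord_bool_inj; rewrite -(cube_code_bit u i (Ordinal jl)).
by rewrite uv cube_code_bit.
Qed.

Lemma cube_code_adj u v : adj (cube_code u) (cube_code v) = adj u v.
Proof.
apply/torus_adjP/torus_adjP=> -[].
  move=> t; rewrite -(enum_valK t); case: (enum_val t) => i j.
  rewrite !cube_code_bit cycle_adj_bool => c E; exists i.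
    apply/cycle_adj_bits; exists j => j'.
    have [->|j'j] := eqVneq j' j; first by [].
    apply/negbTE; rewrite -negb_eqb negbK; apply/eqP/inord_bool_inj.
    rewrite -!cube_code_bit; apply: E.
    by rewrite (inj_eq enum_rank_inj) xpair_eqE (negbTE j'j) andbF.
  move=> i' i'i; apply: val_inj; apply: (@cycle_bit_inj l);
    rewrite -?kl ?ltn_ord // => j' j'l.
  apply: inord_bool_inj; rewrite -!(cube_code_bit _ i' (Ordinal j'l)); apply: E.
  by rewrite (inj_eq enum_rank_inj) xpair_eqE (negbTE i'i).
move=> i /cycle_adj_bits[j E] uv; exists (enum_rank (i, j)).
  by rewrite !cube_code_bit cycle_adj_bool E eqxx.
move=> t; rewrite -(enum_valK t); case: (enum_val t) => i' j'.
rewrite (inj_eq enum_rank_inj) xpair_eqE !cube_code_bit.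
have [->|/uv -> //] := eqVneq i' i; rewrite andTb => j'j.
by have := E j'; rewrite (negbTE j'j); case: cycle_bit; case: cycle_bit.
Qed.

End CubeEmbedding.

(** * Tiling a torus by copies of a set inside the cube *)

Section CubeTile.
Variables (k d : nat) (G0 : sgraph) (V0 : {set G0}) (T : {set torus k.+2 d}).
Hypothesis T_copy : induced_copy V0 T.
Hypothesis T_cube : forall x (i : 'I_d), x \in T -> (x : {ffun _}) i <= 1.

Let S := torus_space k.+2 V0 d.

Lemma translate_tile g (A : {set S}) :
  tile A -> @tile S (translate g @: A).
Proof.
by apply: induced_copy_imset; [exact: translate_inj | exact: translate_adj].
Qed.

Lemma mem_translate g (A : {set S}) (x : S) :
  (x \in translate g @: A) = (translate (- (g : {ffun _}))%R x \in A).
Proof.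
apply/imsetP/idP=> [[y yA ->]|xA]; first by rewrite /translate addrK.
by exists (translate (- (g : {ffun _}))%R x); rewrite // /translate subrK.
Qed.

Lemma spanned_card : spanned (fun _ : S => (#|T|)%:Z%R).
Proof.
have := @spanned_sum S _ (index_enum (torus k.+2 d)) _
          (fun g => spanned_tile (translate_tile g T_copy)).
apply: eq_spanned => x.
(* The translate of [T] by [x - g] contains [x] exactly when [g] is in [T]. *)
rewrite (reindex_inj (@subrI {ffun 'I_d -> 'I_k.+2} x)) /=.
under eq_bigr => g _ do
  rewrite mem_translate /translate opprB addrCA subrr addr0.
rewrite -sum1_card (big_morph Posz PoszD (erefl _)) [RHS]big_mkcond /=.
by apply: eq_bigr => g _; case: (_ \in _).
Qed.

Lemma spans_one_mod_torus p : T != set0 -> prime p -> p %| k.+2 ->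
  spans_one_mod p S.
Proof.
move=> T0 p_pr p_dvd.
pose M (f : S -> 'F_p) := exists2 g : S -> int, spanned g &
  forall x, (g x)%:~R%R = f x.
have M1 : M (fun=> 1%R).
  apply: (@shift_invariant_const k d p p_pr p_dvd M _ _ _ _ _
            (fun x => ((x \in T)%:Z)%:~R)%R).
  - by move=> f g fg [u su uE]; exists u => // x; rewrite uE fg.
  - by exists (fun=> 0%R) => //; apply: spanned0.
  - move=> f g [u su uE] [v sv vE]; exists (fun x => u x + v x)%R.
      exact: spannedD.
    by move=> x; rewrite rmorphD /= uE vE.
  - move=> c f [u su uE]; exists (fun x => (c : nat)%:Z * u x)%R.
      exact: spannedZ.
    by move=> x; rewrite rmorphM /= uE -pmulrn natr_Zp.
  - move=> i a f [u [As [Bs [tA tB uE]]] uf].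
    pose s : S -> S := shift i a.
    pose delta : torus k.+2 d := [ffun j => if j == i then a else 0%R].
    have sE x : s x = translate delta x.
      by apply/ffunP=> j; rewrite !ffunE; case: eqP => [->|] //; rewrite addr0.
    pose pre := map (fun A : {set S} => s @^-1: A).
    (* A shift is the translation by [delta], so its preimage of a tile is the translate by
       [- delta]. *)
    have pre_tile A : @tile S A -> @tile S (s @^-1: A).
      move=> tA'; have := translate_tile (- (delta : {ffun _}))%R tA'.
      congr tile; apply/setP=> x.
      by rewrite mem_translate inE sE opprK.
    have preE Cs x : cover_count (pre Cs) x = cover_count Cs (s x).
      by rewrite /cover_count count_map; apply: eq_count => A; rewrite /= inE.
    exists (fun x => u (s x)); last by move=> x; rewrite uf.
    exists (pre As), (pre Bs); split=> [_ /mapP[A Ain ->]|_ /mapP[B Bin ->]|x].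
    + exact/pre_tile/tA.
    + exact/pre_tile/tB.
    + by rewrite uE !preE.
  - by exists (fun x => (x \in T)%:Z)%R => //; apply: spanned_tile.
  - move=> x i; case xT: (x \in T); last by rewrite eqxx.
    by move=> _; apply: T_cube.
  - by have [x xT] := set0Pn _ T0; exists x; rewrite xT oner_eq0.
have [g sg g1] := M1.
(* Since [g] is 1 modulo [p], the division is exact. *)
exists (fun x => ((1 - g x) %/ p)%Z); apply: eq_spanned sg => x.
rewrite mulrC divzK; first by rewrite opprB addrC subrK.
by rewrite (dvdz_pcharf (pchar_Fp p_pr)) rmorphB /= g1 subrr.
Qed.

(** The divisibility hypothesis is used through primes: each prime factor of [#|T|] divides the
    cycle length. *)
Lemma cube_tile_torus m : #|T| %| k.+2 ^ m ->
  exists n0, forall n, n0 <= n -> tileable [set: torus_space k.+2 V0 n].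
Proof.
move=> T_dvd.
have T0 : 0 < #|T| by apply: dvdn_gt0 T_dvd; rewrite expn_gt0.
have T_n0 : T != set0 by rewrite -card_gt0.
have [p p_pr p_dvd|X [As [Bs [KX tA tB AB]]]] := spanned_one
    (@toroidal_prod k.+2 G0 V0) (toroidal_torus k.+2 V0 d) T0 spanned_card.
  apply: spans_one_mod_torus => //.
  by have := dvdn_trans p_dvd T_dvd; rewrite Euclid_dvdX // => /andP[].
have [t tT] := set0Pn _ T_n0.
(* All the translates of [T]; past the end of the enumeration the default is [T] itself, still a
   tile. The point [x] lies in the translate by [x - t]. *)
pose R i : {set S} :=
  translate (nth (0%R : {ffun _}) (enum S) i) @: (T : {set S}).
have tR i : tileable (R i) by apply/tileable_tile/translate_tile.
have [|Y KY tY] := absorption (@toroidal_prod k.+2 G0 V0) KX tA tB AB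
   (p := #|S|) (toroidal_torus k.+2 V0 d) tR.
  move=> x; exists (index ((x : {ffun _}) - (t : {ffun _}))%R (enum S)).
    by rewrite cardE index_size.
  rewrite /R nth_index ?mem_enum // mem_translate /translate.
  by rewrite opprB addrC subrK.
exact: toroidal_tileable KY tY.
Qed.

End CubeTile.

Lemma tileable_packing k n (G0 : sgraph) (H : subgraph G0) : induced H ->
  tileable [set: torus_space k (sub_vertices H) n] ->
  exists P : {set subgraph (torus k n)},
    [/\ packing (graph_of_subgraph H) P, perfect_packing P & induced_packing P].
Proof.
move=> iH /tileable_partition[P [tP dP covP]].
exists [set @induced_subgraph (torus k n) X | X in P]; split.
- split=> [_ /imsetP[X XP ->]|_ _ /imsetP[X XP ->] /imsetP[Y YP ->] XY].
    exact/induced_copy_iso/tP.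
  by apply: (dP X Y XP YP); apply: contraNneq XY => ->.
- move=> x; have : x \in cover P by rewrite covP inE.
  by move=> /bigcupP[X XP xX]; exists (induced_subgraph X); rewrite ?imset_f.
- by move=> _ /imsetP[X XP ->]; apply: induced_induced_subgraph.
Qed.

Theorem theorem1p4 (k m : nat) (hk : 3 <= k) (hk_even : ~~ odd k)
    (hm : 1 <= m) (H : subgraph (torus k m)) (hH : induced H)
    (hdiv : #|sub_vertices H| %| k ^ m) :
  exists n0 : nat, forall n : nat, n0 <= n ->
    exists P : {set subgraph (torus k n)},
      [/\ packing (graph_of_subgraph H) P,
          perfect_packing P
        & induced_packing P].
Proof.
(* From here on the cycle length is written [k.+2], so that ['I_k.+2] is a ring. *)
case: k hk hk_even H hH hdiv => [|[|k]] // hk hk_even H hH hdiv.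
have kl : k.+2 = (k.+2)./2.*2 by rewrite even_halfK.
have l1 : 1 < (k.+2)./2 by lia.
set code := @cube_code k (k.+2)./2 m.
have code_inj : injective code by apply: cube_code_inj.
have [|||n0 tn0] := @cube_tile_torus k _ _ (sub_vertices H)
    (code @: sub_vertices H) _ _ m.
- exists code; split=> // u v _ _; [exact: code_inj | exact: cube_code_adj].
- by move=> x i /imsetP[u _ ->]; apply: cube_code_le1.
- by rewrite card_imset.
by exists n0 => n /tn0; apply: tileable_packing.
Qed.
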